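(* Let $\{K_j\}_{j=1}^m$ be a clique cover of a finite graph on the node set $[n]$, let $\mathbf{c}\in\mathbb{R}^{n+m}$ be a cost vector with $c_{n+j}=0$ for $j\in[m]$, let $T>0$, and let $\boldsymbol\lambda\in\mathbb{R}^m$ be arbitrary. Run the naive Bregman method (see context) with input $(\boldsymbol\lambda,T)$ for infinitely many iterations. Then its iterates $\mathbf{x}$ converge to the solution of the smoothed clique cover relaxation $$\max_{\mathbf{x}\in[0,1]^{n+m}}\ \langle\mathbf{c},\mathbf{x}\rangle+T\,\mathcal{H}(\mathbf{x})\qquad\text{s.t.}\qquad \sum_{i\in\bar K_j}x_i=1,\ j\in[m].$$
   Context: Notation: $[k]=\{1,\dots,k\}$. Let $\mathcal{G}=(\mathcal{V},\mathcal{E})$ be a finite undirected graph with $\mathcal{V}=[n]$. A clique cover is a family of subsets $K_j\subseteq\mathcal{V}$, $j\in[m]$, each inducing a complete subgraph of $\mathcal{G}$, that covers all edges and nodes: $\mathcal{E}=\bigcup_{j}\{\{i,i'\}\mid i,i'\in K_j,\ i\neq i'\}$ and $\mathcal{V}=\bigcup_j K_j$. For each clique introduce a slack index $n+j$ with cost $c_{n+j}=0$ and put $\bar K_j=K_j\cup\{n+j\}$. For $i\in[n+m]$ let $J_i=\{j\in[m]\mid i\in\bar K_j\}$. For $\boldsymbol\lambda\in\mathbb{R}^m$ the reduced costs are $c^{\boldsymbol\lambda}_i=c_i-\sum_{j\in J_i}\lambda_j$, $i\in[n+m]$. The (shifted) entropy is $\mathcal{H}(\mathbf{x})=-\sum_{i=1}^{n+m}(x_i\log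 x_i-x_i)$ with $0\log0=0$. Naive Bregman method. Input: $\boldsymbol\lambda\in\mathbb{R}^m$, $T>0$. Initialize $x_i=\exp(c^{\boldsymbol\lambda}_i/T)$ for all $i\in[n+m]$. Repeat outer iterations; each outer iteration loops over the cliques $j=1,\dots,m$ and for each $j$ computes $s:=\sum_{i\in\bar K_j}x_i$ and then updates $x_i:=x_i/s$ for all $i\in\bar K_j$ (other coordinates unchanged). *)

(* Defs.v *)
From HB Require Import structures.
From mathcomp Require Import all_boot all_order all_algebra.
From mathcomp Require Import all_classical all_reals all_analysis.

Set Implicit Arguments.
Unset Strict Implicit.
Unset Printing Implicit Defensive.

Import Order.TTheory GRing.Theory Num.Theory.
Import numFieldNormedType.Exports.

Local Open Scope ring_scope.

(* A graph on the node set 'I_n is given by its set of edges, each edge being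
   an unordered pair of distinct nodes. *)
Definition is_edge_set (n : nat) (E : {set {set 'I_n}}) : Prop :=
  forall A : {set 'I_n}, A \in E -> #|A| = 2%N.

Definition is_clique (n : nat) (E : {set {set 'I_n}}) (A : {set 'I_n}) : Prop :=
  forall i i' : 'I_n, i \in A -> i' \in A -> i != i' -> [set i; i']%SET \in E.

Definition is_clique_cover (n m : nat) (E : {set {set 'I_n}})
    (K : 'I_m -> {set 'I_n}) : Prop :=
  [/\ forall j : 'I_m, is_clique E (K j),
      E = (\bigcup_(j < m)
             [set [set i; i'] | i in K j, i' in K j & i != i'])%SET
    & [set: 'I_n]%SET = (\bigcup_(j < m) K j)%SET].

(* In 'I_(n + m), node i is [lshift m i] and the slack index of the j-th
   clique is [rshift n j]. *)
Definition ext_clique (n m : nat) (K : 'I_m -> {set 'I_n}) (j : 'I_m) :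
    {set 'I_(n + m)} :=
  (rshift n j |: [set lshift m i | i in K j])%SET.

Definition cliques_of (n m : nat) (K : 'I_m -> {set 'I_n}) (i : 'I_(n + m)) :
    {set 'I_m} :=
  [set j | i \in ext_clique K j]%SET.

Section Relaxation.
Variables (R : realType) (n m : nat) (K : 'I_m -> {set 'I_n}).
Implicit Types (c x : 'rV[R]_(n + m)) (T : R) (lambda : 'rV[R]_m).

Definition reduced_cost c lambda (i : 'I_(n + m)) : R :=
  c 0 i - \sum_(j in cliques_of K i) lambda 0 j.

(* [ln 0 = 0] in the library, so the convention 0 log 0 = 0 holds. *)
Definition entropy x : R :=
  - \sum_(i < n + m) (x 0 i * ln (x 0 i) - x 0 i).

Definition smoothed_objective c T x : R :=
  \sum_(i < n + m) c 0 i * x 0 i + T * entropy x.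

Definition feasible x : Prop :=
  (forall i : 'I_(n + m), 0 <= x 0 i <= 1) /\
  (forall j : 'I_m, \sum_(i in ext_clique K j) x 0 i = 1).

Definition is_solution c T x : Prop :=
  feasible x /\
  (forall y, feasible y -> smoothed_objective c T y <= smoothed_objective c T x).

Definition bregman_init c lambda T : 'rV[R]_(n + m) :=
  \row_i expR (reduced_cost c lambda i / T).

Definition bregman_step x (j : 'I_m) : 'rV[R]_(n + m) :=
  let s := \sum_(i in ext_clique K j) x 0 i in
  \row_i (if i \in ext_clique K j then x 0 i / s else x 0 i).

Definition bregman_outer x : 'rV[R]_(n + m) :=
  foldl bregman_step x (enum 'I_m).

(* The vector after [t] clique updates in total, that is [t %/ m] complete
   outer iterations followed by the first [t %% m] updates of the next one
   (for m = 0 there are no updates and the sequence is constant). *)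
Definition bregman_iterate c lambda T (t : nat) : 'rV[R]_(n + m) :=
  foldl bregman_step (iter (t %/ m)%N bregman_outer (bregman_init c lambda T))
    (take (t %% m)%N (enum 'I_m)).

End Relaxation.

(* Main.v *)
(* For every y meeting the constraints, rescaling a clique of mass s lowers the
   generalized Kullback-Leibler divergence kl y x by s - 1 - ln s >= 0. Hence
   the masses tend to 1, and testing with a positive feasible y keeps the
   iterates in a compact subset of the open orthant. A limit point is feasible,
   and it inherits the stationarity relation that every update preserves, so the
   objective at a feasible y equals a constant minus T * kl y xs: the limit point
   xs is the unique solution. Finally kl xs (x t) is nonincreasing and tends to
   0 along a subsequence, so the whole sequence converges. *)
Require Import Defs.
From HB Require Import structures.
From mathcomp Require Import all_boot all_order all_algebra.
From mathcomp Require Import all_classical all_reals all_analysis.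
From mathcomp Require Import ring lra.

Set Implicit Arguments.
Unset Strict Implicit.
Unset Printing Implicit Defensive.

Import Order.TTheory GRing.Theory Num.Theory.
Import numFieldNormedType.Exports.

Local Open Scope classical_set_scope.
Local Open Scope ring_scope.

(** * Scalar inequalities for the logarithm and the divergence terms *)

Section RealFacts.
Variable R : realType.
Implicit Types (x y s : R).

Lemma ln_le_subr1 x : 0 < x -> ln x <= x - 1.
Proof.
move=> x0; have -> : ln x = ln (1 + (x - 1)) by rewrite subrKC.
by apply: le_ln1Dx; lra.
Qed.

(** With [r] the square root of [x], [ln x = 2 ln r <= 2 (r - 1)], and [r ^+ 2 - 1 - 2 (r - 1)] is a
    square. *)
Lemma subr1_ln_ge_sqr x : 0 < x -> (Num.sqrt x - 1) ^+ 2 <= x - 1 - ln x.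
Proof.
move=> x0; set r := Num.sqrt x.
have r0 : 0 < r by rewrite sqrtr_gt0.
have xr : x = r ^+ 2 by rewrite sqr_sqrtr ?ltW.
rewrite xr lnXn //; have := ln_le_subr1 r0; rewrite mulr2n; lra.
Qed.

(** Bregman divergence of [t * ln t - t]; at [y = 0] it equals [x]. *)
Definition kl_term y x : R := y * (ln y - ln x) - y + x.

(** A Hellinger-type bound: for [y > 0] the term is [y * (x / y - 1 - ln (x / y))], so the previous
    bound applies at [x / y]. *)
Lemma kl_term_ge y x : 0 <= y -> 0 < x ->
  (Num.sqrt x - Num.sqrt y) ^+ 2 <= kl_term y x.
Proof.
rewrite le_eqVlt /kl_term => /orP[/eqP <-|y0] x0.
  by rewrite sqrtr0 mul0r !subr0 add0r sqr_sqrtr // ltW.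
have xy0 : 0 < x / y by rewrite divr_gt0.
have := subr1_ln_ge_sqr xy0.
rewrite -(ler_pM2l y0) ln_div ?posrE // sqrtrM ?(ltW x0) // sqrtrV ?(ltW y0) // => H.
have ysq : Num.sqrt y ^+ 2 = y by rewrite sqr_sqrtr ?ltW.
have sy0 : Num.sqrt y != 0 by rewrite gt_eqF // sqrtr_gt0.
have -> : (Num.sqrt x - Num.sqrt y) ^+ 2 =
    Num.sqrt y ^+ 2 * (Num.sqrt x / Num.sqrt y - 1) ^+ 2 by field.
rewrite ysq.
have -> : y * (ln y - ln x) - y + x = y * (x / y - 1 - (ln x - ln y)).
  by field; rewrite gt_eqF.
exact: H.
Qed.

Lemma kl_term_ge0 y x : 0 <= y -> 0 < x -> 0 <= kl_term y x.
Proof. by move=> y0 x0; apply: le_trans (kl_term_ge y0 x0); exact: sqr_ge0. Qed.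

Lemma kl_term_eq0 y x : 0 <= y -> 0 < x -> kl_term y x = 0 -> y = x.
Proof.
move=> y0 x0 kl0; have := kl_term_ge y0 x0; rewrite kl0.
rewrite le_eqVlt ltNge sqr_ge0 orbF sqrf_eq0 subr_eq0 => /eqP sxy.
by rewrite -(sqr_sqrtr y0) -sxy sqr_sqrtr // ltW.
Qed.

Lemma kl_term_refl x : kl_term x x = 0.
Proof. by rewrite /kl_term subrr mulr0 add0r addNr. Qed.

Lemma kl_term_bound y C : 0 < y ->
  exists a b : R, 0 < a /\ forall x, 0 < x -> kl_term y x <= C -> a <= x <= b.
Proof.
(* The lower end solves [y * (ln y - ln a) - y = C]. For the upper end, [d ^+ 2 <= C] with [d] the
   difference of the square roots gives [2 d <= d ^+ 2 + 1 <= C + 1]. *)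
move=> y0; exists (expR (ln y - 1 - C / y)), ((Num.sqrt y + C + 1) ^+ 2).
split; first exact: expR_gt0.
move=> x x0 xC; apply/andP; split.
  rewrite -ler_ln ?posrE ?expR_gt0 // expRK.
  have : (y * (ln y - ln x) - y) / y <= C / y.
    rewrite ler_pM2r ?invr_gt0 //; move: xC; rewrite /kl_term; lra.
  rewrite mulrBl mulrAC mulfV ?gt_eqF // mul1r; lra.
have d := le_trans (kl_term_ge (ltW y0) x0) xC.
have C0 : 0 <= C by apply: le_trans d; exact: sqr_ge0.
rewrite -(sqr_sqrtr (ltW x0)) ler_pXn2r ?nnegrE ?addr_ge0 ?sqrtr_ge0 //.
have := sqr_ge0 (Num.sqrt x - Num.sqrt y - 1); nra.
Qed.

(** * Limits of real and vector sequences *)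

Lemma cvg_of_sqrt_dist (u d : nat -> R) (l : R) : (forall t, 0 <= u t) ->
  0 <= l -> (forall t, (Num.sqrt (u t) - Num.sqrt l) ^+ 2 <= d t) ->
  d @ \oo --> (0 : R) -> u @ \oo --> l.
Proof.
move=> u0 l0 ud d0.
have h : (fun t => Num.sqrt (u t)) @ \oo --> Num.sqrt l.
  apply/cvgrPdist_lt => e e0; have e20 : 0 < e ^+ 2 by rewrite exprn_gt0.
  move/cvgrPdist_lt: d0 => /(_ _ e20); apply: filterS => t.
  rewrite sub0r normrN => /(le_lt_trans (ler_norm _)) H.
  rewrite distrC -(ltr_pXn2r (n:=2)) // ?nnegrE ?normr_ge0 ?ltW //.
  by rewrite real_normK ?num_real //; exact: le_lt_trans (ud t) H.
rewrite (_ : u = (fun t => Num.sqrt (u t) * Num.sqrt (u t))).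
  by rewrite -[X in _ --> X](sqr_sqrtr l0) expr2; exact: cvgM.
by apply/funext => t; rewrite -expr2 sqr_sqrtr.
Qed.

Lemma cvg_subr1_ln (s : nat -> R) : (forall t, 0 < s t) ->
  (s t - 1 - ln (s t)) @[t --> \oo] --> (0 : R) -> s @ \oo --> (1 : R).
Proof.
move=> s0; apply: cvg_of_sqrt_dist => // t; first exact: ltW.
by rewrite sqrtr1; exact: subr1_ln_ge_sqr.
Qed.

(** From any late [t], the value [l] is at most [p] increments away, each of size at most
    [e / p.+1]. *)
Lemma cvg_of_recurrent_value (h : nat -> R) (l : R) (p : nat) :
  (h t.+1 - h t) @[t --> \oo] --> (0 : R) ->
  (forall t, exists2 k, (k <= p)%N & h (t + k)%N = l) -> h @ \oo --> l.
Proof.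
move=> dh hl; apply/cvgrPdist_le => e e0.
have ep0 : 0 < e / p.+1%:R by rewrite divr_gt0 ?ltr0n.
move/cvgrPdist_le: dh => /(_ _ ep0)[N _ HN].
exists N => // t /= Nt; have [k kp <-] := hl t.
have {kp} : k%:R * (e / p.+1%:R) <= e.
  rewrite mulrCA ger_pMr // ler_pdivrMr ?ltr0n // mul1r ler_nat.
  exact: leqW.
apply: le_trans.
elim: k => [|k IH]; first by rewrite addn0 subrr normr0 mul0r.
have := HN (t + k)%N (leq_trans Nt (leq_addr _ _)).
rewrite sub0r normrN -addnS => H.
have -> : h (t + k.+1)%N - h t = (h (t + k.+1)%N - h (t + k)%N) + (h (t + k)%N - h t) by ring.
apply: le_trans (ler_normD _ _) _; rewrite -natr1 mulrDl mul1r addrC.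
exact: lerD.
Qed.

Lemma cvg_sum (I : Type) (r : seq I) (P : pred I) (f : nat -> I -> R)
    (l : I -> R) : (forall i, P i -> f t i @[t --> \oo] --> l i) ->
  (\sum_(i <- r | P i) f t i) @[t --> \oo] --> \sum_(i <- r | P i) l i.
Proof.
by move=> fl; apply: cvg_big => //; exact: add_continuous.
Qed.

Lemma rV_cvg (N : nat) (u : nat -> 'rV[R]_N) (x : 'rV[R]_N) :
  (forall i, u t 0 i @[t --> \oo] --> x 0 i) -> u @ \oo --> x.
Proof.
move=> H; apply/cvg_ballP => e e0.
have : \forall t \near \oo, forall i, ball (x 0 i) e (u t 0 i).
  apply: filter_forall => i; exact: (cvg_ball (H i)).
by apply: filterS => t Ht; split=> // i j; rewrite ord1.
Qed.

(** Bolzano-Weierstrass in a box. The index map need not be increasing: [k <= f k] already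
    transports limits, by [cvg_subseq]. *)
Lemma rV_box_subsequence (N : nat) (u : nat -> 'rV[R]_N) (a b : 'I_N -> R) :
  (forall t i, a i <= u t 0 i <= b i) ->
  exists (x : 'rV[R]_N) (f : nat -> nat),
    [/\ forall i, a i <= x 0 i, forall k, (k <= f k)%N
      & forall i, u (f k) 0 i @[k --> \oo] --> x 0 i].
Proof.
move=> uab.
have comp : compact [set v : 'rV[R]_N | forall i, `[a i, b i]%classic (v ord0 i)].
  by apply: (@rV_compact R N (fun i => `[a i, b i]%classic)) => i;
    exact: segment_compact.
have [|x [xab clx]] := comp (u @ \oo) _.
  by exists 0%N => // t _ i /=; rewrite in_itv /= uab.
(* The cluster point is approached within [1 / (k + 1)] at some index beyond [k]. *)
have ex k : exists t, (k <= t)%N /\ forall i, `|x 0 i - u t 0 i| < k.+1%:R^-1.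
  have H1 : (u @ \oo) (u @` [set t | (k <= t)%N]).
    by exists k => // t /= kt; exists t.
  have H2 : nbhs x (ball x (k.+1%:R^-1 : R)).
    by apply: nbhsx_ballx; rewrite invr_gt0 ltr0n.
  have [_ [[t /= kt <-] bt]] := clx _ _ H1 H2.
  by exists t; split=> // i; case: bt => _; exact.
have [f Hf] := choice ex.
exists x, f; split => [i|k|i].
- by have := xab i; rewrite /= in_itv /= => /andP[].
- by have [] := Hf k.
apply/cvgrPdist_lt => e e0.
have := near_infty_natSinv_lt (PosNum e0); apply: filterS => k /= ke.
by apply: lt_trans ke; have [_] := Hf k; exact.
Qed.

Lemma cvg_subseq (f : nat -> nat) (u : nat -> R) (l : R) :
  (forall k, (k <= f k)%N) -> u @ \oo --> l -> u (f k) @[k --> \oo] --> l.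
Proof.
move=> kf ul; apply: cvg_comp ul => A [N _ HN].
by exists N => // k /= Nk; apply: HN => /=; exact: leq_trans (kf k).
Qed.

End RealFacts.

(** * The generalized Kullback-Leibler divergence of vectors *)

Section KullbackLeibler.
Variables (R : realType) (N : nat).
Implicit Types x y : 'rV[R]_N.

Definition kl y x : R := \sum_i kl_term (y 0 i) (x 0 i).

Lemma kl_ge0 y x : (forall i, 0 <= y 0 i) -> (forall i, 0 < x 0 i) ->
  0 <= kl y x.
Proof. by move=> y0 x0; apply: sumr_ge0 => i _; exact: kl_term_ge0. Qed.

Lemma kl_term_le_kl y x i : (forall i, 0 <= y 0 i) -> (forall i, 0 < x 0 i) ->
  kl_term (y 0 i) (x 0 i) <= kl y x.
Proof.
move=> y0 x0; rewrite /kl (bigD1 i) //= lerDl.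
by apply: sumr_ge0 => k _; exact: kl_term_ge0.
Qed.

Lemma kl_refl x : kl x x = 0.
Proof. by rewrite /kl big1 // => i _; exact: kl_term_refl. Qed.

Lemma kl_eq0 y x : (forall i, 0 <= y 0 i) -> (forall i, 0 < x 0 i) ->
  kl y x = 0 -> y = x.
Proof.
move=> y0 x0 /eqP; rewrite psumr_eq0; last by move=> i _; exact: kl_term_ge0.
move=> /allP H; apply/rowP => i; apply: kl_term_eq0 => //.
by apply/eqP/H; rewrite mem_index_enum.
Qed.

Lemma kl_cvg0 (u : nat -> 'rV[R]_N) x : (forall i, 0 < x 0 i) ->
  (forall i, u t 0 i @[t --> \oo] --> x 0 i) -> kl x (u t) @[t --> \oo] --> 0.
Proof.
move=> x0 ux; rewrite -(kl_refl x); apply: cvg_sum => i _ /=.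
apply: cvgD (ux i); apply: cvgB; last exact: cvg_cst.
apply: cvgM; first exact: cvg_cst.
apply: cvgB; first exact: cvg_cst.
exact: (continuous_cvg _ (continuous_ln (x0 i)) (ux i)).
Qed.

Lemma cvg_of_kl_cvg0 (u : nat -> 'rV[R]_N) x : (forall i, 0 <= x 0 i) ->
  (forall t i, 0 < u t 0 i) -> kl x (u t) @[t --> \oo] --> 0 -> u @ \oo --> x.
Proof.
move=> x0 u0 kl0; apply: rV_cvg => i.
apply: cvg_of_sqrt_dist kl0 => // t; first exact: ltW.
exact: le_trans (kl_term_ge _ _) (kl_term_le_kl _ _ _).
Qed.

End KullbackLeibler.

(** * A single clique update: mass, divergence and stationarity *)

Section Bregman.
Variables (R : realType) (n m : nat) (K : 'I_m -> {set 'I_n}).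
Implicit Types (c x y : 'rV[R]_(n + m)) (T : R) (lambda : 'rV[R]_m).
Local Notation S := (ext_clique K).
Local Notation mass x j := (\sum_(i in S j) x 0 i).

Lemma slack_in_ext_clique (j k : 'I_m) : (rshift n k \in S j) = (k == j).
Proof.
rewrite /ext_clique !inE (inj_eq (@rshift_inj n m)).
case: eqP => //= _; apply/imsetP => -[i _ /eqP].
by rewrite eq_rlshift.
Qed.

Lemma mass_gt0 x j : (forall i, 0 < x 0 i) -> 0 < mass x j.
Proof.
move=> x0; rewrite (bigD1 (rshift n j)) ?slack_in_ext_clique //=.
by rewrite ltr_pwDl // sumr_ge0 // => i _; exact: ltW.
Qed.

Lemma bregman_step_gt0 x j : (forall i, 0 < x 0 i) ->
  forall i, 0 < bregman_step K x j 0 i.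
Proof.
move=> x0 i; rewrite mxE; case: ifP => // _.
by rewrite divr_gt0 // mass_gt0.
Qed.

Lemma mass_bregman_step x j : (forall i, 0 < x 0 i) ->
  mass (bregman_step K x j) j = 1.
Proof.
move=> x0; under eq_bigr => i iS do rewrite mxE iS.
by rewrite -mulr_suml divff // gt_eqF // mass_gt0.
Qed.

Lemma ln_bregman_step x j i : (forall i, 0 < x 0 i) ->
  ln (bregman_step K x j 0 i) = ln (x 0 i) - (i \in S j)%:R * ln (mass x j).
Proof.
move=> x0; rewrite mxE; case: ifP => _; last by rewrite mul0r subr0.
by rewrite mul1r ln_div // posrE // mass_gt0.
Qed.

(** Only coordinates in the clique contribute, each [x i - x i / s - y i * ln s]; summing with mass
    [s] for [x] and [1] for [y] gives the decrease. *)
Lemma kl_bregman_step y x j : (forall i, 0 < x 0 i) -> mass y j = 1 ->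
  kl y (bregman_step K x j) = kl y x - (mass x j - 1 - ln (mass x j)).
Proof.
move=> x0 y1; set s := mass x j.
have s0 : 0 < s by exact: mass_gt0.
apply/eqP; rewrite eq_sym subr_eq addrC -subr_eq /kl -sumrB; apply/eqP.
rewrite (bigID (mem (S j))) /= [X in _ + X]big1 => [|i /negbTE iS]; last first.
  by rewrite mxE iS subrr.
rewrite addr0.
transitivity (\sum_(i in S j) (x 0 i - x 0 i / s - y 0 i * ln s)).
  apply: eq_bigr => i iS; rewrite /kl_term ln_bregman_step // iS mul1r -/s mxE iS -/s.
  ring.
by rewrite !sumrB -!mulr_suml -/s y1 divff ?gt_eqF // mul1r.
Qed.

(** The change is [(x i / s) * (1 - s)], and [x i <= s] inside the clique. *)
Lemma bregman_step_dist x j i : (forall i, 0 < x 0 i) ->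
  `|bregman_step K x j 0 i - x 0 i| <= `|mass x j - 1|.
Proof.
move=> x0; rewrite mxE; case: ifP => [iS|_]; last by rewrite subrr normr0.
have s0 : 0 < mass x j by exact: mass_gt0.
have -> : x 0 i / mass x j - x 0 i = x 0 i / mass x j * (1 - mass x j).
  by field; rewrite gt_eqF.
rewrite normrM distrC ler_piMl // ger0_norm ?divr_ge0 ?(ltW s0) ?(ltW (x0 i)) //.
rewrite ler_pdivrMr // mul1r (bigD1 i) //= lerDl.
by rewrite sumr_ge0 // => k _; exact: ltW.
Qed.

(* Stationarity of the Lagrangian, with the multiplier of the [j]-th constraint
   eliminated through the slack coordinate. *)
Definition stationary c T x : Prop := forall i,
  ln (x 0 i) = c 0 i / T + \sum_(j in cliques_of K i) ln (x 0 (rshift n j)).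

(** A slack has cost 0 and lies in its own clique only, so its initial logarithm is
    [- lambda j / T], the very term that reduced costs contain. *)
Lemma stationary_init c lambda T : (forall j, c 0 (rshift n j) = 0) ->
  stationary c T (bregman_init K c lambda T).
Proof.
move=> c0 i; rewrite mxE expRK /reduced_cost mulrBl; congr (_ + _).
rewrite mulr_suml -sumrN; apply: eq_bigr => j _.
rewrite mxE expRK /reduced_cost c0 sub0r mulNr; congr (- (_ / _)).
rewrite (big_pred1 j) // => k.
by rewrite inE slack_in_ext_clique eq_sym.
Qed.

(** Among the slacks only that of [j] changes, so both sides lose [ln s] exactly when [i] lies in
    clique [j]. *)
Lemma stationary_step c T x j : (forall i, 0 < x 0 i) -> stationary c T x ->
  stationary c T (bregman_step K x j).
Proof.
move=> x0 st i; rewrite ln_bregman_step // st.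
under [in RHS]eq_bigr => k _ do rewrite ln_bregman_step // slack_in_ext_clique.
rewrite sumrB addrA; congr (_ - _).
rewrite -mulr_suml; congr (_ * _).
rewrite (bigID (pred1 j)) /= [X in _ + X]big1 ?addr0 => [|k /andP[_ /negbTE->] //].
have [iS|iS] := boolP (i \in S j).
  rewrite (big_pred1 j) ?eqxx // => k; rewrite inE.
  by apply: andb_idl => /eqP ->.
rewrite big_pred0 // => k; rewrite inE.
by case: eqP => [->|]; rewrite ?andbF ?(negbTE iS).
Qed.

Lemma objective_stationary c T x y : 0 < T -> stationary c T x ->
  (forall j, mass y j = 1) ->
  smoothed_objective c T y =
  T * (\sum_i x 0 i - \sum_j ln (x 0 (rshift n j)) - kl y x).
Proof.
move=> T0 st y1.
(* Insert stationarity and exchange the sums: each multiplier is then weighted by a mass of [y],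
   which is 1. *)
have E : \sum_i y 0 i * ln (x 0 i) =
    (\sum_i c 0 i * y 0 i) / T + \sum_j ln (x 0 (rshift n j)).
  under eq_bigr => i _ do rewrite st mulrDr.
  rewrite big_split mulr_suml; congr (_ + _).
    by apply: eq_bigr => i _; rewrite mulrCA mulrA.
  under eq_bigr => i _ do rewrite mulr_sumr.
  rewrite (exchange_big_dep xpredT) //=; apply: eq_bigr => j _.
  rewrite -mulr_suml -[RHS]mul1r -(y1 j); congr (_ * _).
  by apply: eq_bigl => i; rewrite inE.
have F : kl y x = \sum_i (y 0 i * ln (y 0 i) - y 0 i)
                  - \sum_i y 0 i * ln (x 0 i) + \sum_i x 0 i.
  by rewrite -sumrB -big_split /=; apply: eq_bigr => i _; rewrite /kl_term; ring.
rewrite /smoothed_objective /entropy F E.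
by field; rewrite gt_eqF.
Qed.

Lemma stationary_solution c T x : 0 < T -> (forall i, 0 < x 0 i) ->
  stationary c T x -> feasible K x ->
  is_solution K c T x /\ forall y, is_solution K c T y -> y = x.
Proof.
move=> T0 x0 st fx.
have obj y : feasible K y ->
    smoothed_objective c T y = smoothed_objective c T x - T * kl y x.
  move=> [_ y1]; rewrite !(objective_stationary T0 st) //; last by case: fx.
  by rewrite kl_refl; ring.
have kl0 y : feasible K y -> 0 <= kl y x.
  by move=> [yb _]; apply: kl_ge0 => // i; case/andP: (yb i).
split=> [|y [fy /(_ _ fx)]].
  split=> // y fy; rewrite obj // gerBl.
  by rewrite mulr_ge0 ?kl0 // ltW.
rewrite (obj y fy) => H; apply: kl_eq0 => //.
  by move=> i; case: fy => yb _; case/andP: (yb i).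
apply/eqP; rewrite eq_le kl0 // andbT.
by move: H; rewrite lerBrDr gerDl pmulr_rle0.
Qed.

Lemma feasible_of_mass x : (forall i, exists j, i \in S j) ->
  (forall i, 0 < x 0 i) -> (forall j, mass x j = 1) -> feasible K x.
Proof.
move=> cover x0 x1; split=> // i; rewrite ltW //=.
have [j iS] := cover i; rewrite -(x1 j) (bigD1 i) //= lerDl.
by rewrite sumr_ge0 // => k _; exact: ltW.
Qed.

Lemma mass_split x j :
  mass x j = x 0 (rshift n j) + \sum_(i in K j) x 0 (lshift m i).
Proof.
rewrite /ext_clique big_setU1 /=; last first.
  by apply/imsetP => -[i _ /eqP]; rewrite eq_rlshift.
by rewrite big_imset //= => i k _ _; exact: lshift_inj.
Qed.

Lemma positive_mass1_exists :
  exists2 y : 'rV[R]_(n + m), forall i, 0 < y 0 i & forall j, mass y j = 1.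
Proof.
(* Nodes get [1 / (n + 1)] and each slack the remainder, positive because a clique has at most [n]
   nodes. *)
exists (\row_(i < n + m) match fintype.split i with
               | inl _ => n.+1%:R^-1
               | inr j => 1 - #|K j|%:R / n.+1%:R end).
  move=> i; rewrite mxE; case: fintype.split => [_|j]; first by rewrite invr_gt0 ltr0n.
  rewrite subr_gt0 ltr_pdivrMr ?ltr0n // mul1r ltr_nat ltnS.
  by rewrite -[X in (_ <= X)%N](card_ord n) max_card.
move=> j; rewrite mass_split mxE (unsplitK (inr j)).
under eq_bigr => i _ do rewrite mxE (unsplitK (inl i)).
by rewrite sumr_const -[n.+1%:R^-1 *+ _]mulr_natl subrK.
Qed.

End Bregman.

(** * Unfolding the iterates into single clique updates *)

Section Convergence.
Variables (R : realType) (n m : nat) (K : 'I_m -> {set 'I_n}).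
Implicit Types (c x y : 'rV[R]_(n + m)) (T : R) (lambda : 'rV[R]_m).
Local Notation S := (ext_clique K).
Local Notation mass x j := (\sum_(i in S j) x 0 i).

Lemma bregman_iterate0 c lambda T :
  bregman_iterate K c lambda T 0 = bregman_init K c lambda T.
Proof. by rewrite /bregman_iterate div0n mod0n take0. Qed.

Lemma bregman_iterateS c lambda T t (j : 'I_m) : (t %% m)%N = j ->
  bregman_iterate K c lambda T t.+1 =
  bregman_step K (bregman_iterate K c lambda T t) j.
Proof.
move=> tj; have m0 : (0 < m)%N by exact: leq_ltn_trans (ltn_ord j).
have take_enum : take j.+1 (enum 'I_m) = rcons (take j (enum 'I_m)) j.
  by rewrite (take_nth j) ?size_enum_ord // nth_ord_enum.
rewrite /bregman_iterate divnS // modnS tj.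
case: ifP => [dvd|_]; last by rewrite take_enum foldl_rcons.
(* Here [m] divides [t.+1], so [j] is the last clique and its update completes an outer
   iteration. *)
rewrite take0 add1n iterS /= -foldl_rcons -take_enum /bregman_outer.
rewrite take_oversize // size_enum_ord.
move: dvd; rewrite /dvdn -addn1 -modnDml tj addn1.
by apply: contraLR; rewrite -ltnNge => jm; rewrite modn_small.
Qed.

(** * Convergence for any order visiting each clique in every window of [p.+1] updates *)

Variables (c : 'rV[R]_(n + m)) (T : R) (x : nat -> 'rV[R]_(n + m)).
Variables (ctl : nat -> 'I_m) (p : nat).
Hypotheses (T_gt0 : 0 < T) (cover : forall i, exists j, i \in S j).
Hypotheses (x00 : forall i, 0 < x 0%N 0 i) (st0 : stationary K c T (x 0%N)).
Hypothesis xS : forall t, x t.+1 = bregman_step K (x t) (ctl t).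
Hypothesis ctl_rec : forall t j, exists2 k, (k <= p)%N & ctl (t + k)%N = j.

Let s t := mass (x t) (ctl t).

Let x_gt0 t i : 0 < x t 0 i.
Proof.
elim: t i => [|t IH] i; first exact: x00.
by rewrite xS; exact: bregman_step_gt0.
Qed.

Let x_stationary t : stationary K c T (x t).
Proof. by elim: t => // t IH; rewrite xS; exact: stationary_step. Qed.

Section Fejer.
Variable y : 'rV[R]_(n + m).
Hypotheses (y_ge0 : forall i, 0 <= y 0 i) (y1 : forall j, mass y j = 1).

Let klS t : kl y (x t.+1) = kl y (x t) - (s t - 1 - ln (s t)).
Proof. by rewrite xS kl_bregman_step. Qed.

Let kl_nonincreasing : nonincreasing_seq (fun t => kl y (x t)).
Proof.
apply/nonincreasing_seqP => t; rewrite klS gerBl.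
by apply: le_trans (subr1_ln_ge_sqr (mass_gt0 _ _ _)); rewrite ?sqr_ge0.
Qed.

Lemma kl_iterate_le0 t : kl y (x t) <= kl y (x 0%N).
Proof. exact: kl_nonincreasing. Qed.

Lemma kl_iterate_cvg : cvgn (fun t => kl y (x t)).
Proof.
apply: nonincreasing_is_cvgn => //.
by exists 0 => _ [t _ <-]; exact: kl_ge0.
Qed.

(** The quantities [s t - 1 - ln (s t)] are the decrements of a convergent sequence, hence tend to
    0. *)
Lemma scale_cvg1 : s @ \oo --> (1 : R).
Proof.
apply: cvg_subr1_ln => [t|]; first exact: mass_gt0.
have -> : (fun t => s t - 1 - ln (s t)) =
    (fun t => kl y (x t) - kl y (x t.+1)).
  by apply/funext => t; rewrite klS; ring.
have /cvg_ex[l kll] := kl_iterate_cvg.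
rewrite -[X in _ --> X](subrr l); apply: cvgB; first exact: kll.
by have := kll; rewrite -cvg_shiftS.
Qed.

End Fejer.

Let s_cvg1 : s @ \oo --> (1 : R).
Proof.
have [y y0 y1] := positive_mass1_exists R K.
by apply: (@scale_cvg1 y) => // i; exact: ltW.
Qed.

(** [s] only sees the clique being updated. For a fixed [j], the mass is exactly 1 right after each
    update of [j], hence the bound [p.+1], and its increments vanish because coordinates move by at
    most [|s t - 1|]. *)
Let mass_cvg1 j : mass (x t) j @[t --> \oo] --> (1 : R).
Proof.
apply: (@cvg_of_recurrent_value _ _ _ p.+1).
  rewrite [X in _ --> X](_ : 0 = \sum_(i in S j) 0); last by rewrite big1.
  under eq_fun do rewrite -sumrB.
  apply: cvg_sum => i _; apply/cvgrPdist_lt => e e0.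
  move/cvgrPdist_lt: s_cvg1 => /(_ _ e0); apply: filterS => t.
  rewrite sub0r normrN distrC; apply: le_lt_trans.
  by rewrite xS; exact: bregman_step_dist.
move=> t; have [k kp <-] := ctl_rec t j; exists k.+1 => //.
by rewrite addnS xS mass_bregman_step.
Qed.

Let x_box : exists a b : 'I_(n + m) -> R,
  (forall i, 0 < a i) /\ forall t i, a i <= x t 0 i <= b i.
Proof.
have [y y0 y1] := positive_mass1_exists R K.
have y_ge0 i : 0 <= y 0 i by exact: ltW.
have /choice[ab Hab] : forall i, exists ab : R * R,
    0 < ab.1 /\ forall t, ab.1 <= x t 0 i <= ab.2.
  move=> i; have [a [b [a0 H]]] := kl_term_bound (kl y (x 0%N)) (y0 i).
  exists (a, b); split=> // t; apply: H => //.
  by apply: le_trans (kl_term_le_kl _ _ _) _ => //; exact: kl_iterate_le0.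
exists (fun i => (ab i).1), (fun i => (ab i).2).
by split=> [i|t i]; have [] := Hab i.
Qed.

Lemma bregman_cvg : exists xs : 'rV[R]_(n + m),
  [/\ is_solution K c T xs, forall y, is_solution K c T y -> y = xs
    & x @ \oo --> xs].
Proof.
have [a [b [a0 xab]]] := x_box.
have [xs [f [axs kf fxs]]] := rV_box_subsequence xab.
have xs0 i : 0 < xs 0 i by exact: lt_le_trans (axs i).
have xs1 j : mass xs j = 1.
  have h1 : mass (x (f k)) j @[k --> \oo] --> mass xs j.
    by apply: cvg_sum => i _; exact: fxs.
  have h2 := cvg_subseq kf (mass_cvg1 j).
  exact: (cvg_unique _ h1 h2).
have ln_fxs i : ln (x (f k) 0 i) @[k --> \oo] --> ln (xs 0 i).
  exact: (continuous_cvg _ (continuous_ln (xs0 i)) (fxs i)).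
have xs_st : stationary K c T xs.
  move=> i; have h : ln (x (f k) 0 i) @[k --> \oo] -->
      c 0 i / T + \sum_(j in cliques_of K i) ln (xs 0 (rshift n j)).
    under eq_fun do rewrite x_stationary.
    apply: cvgD; first exact: cvg_cst.
    by apply: cvg_sum => j _; exact: ln_fxs.
  exact: (cvg_unique _ (ln_fxs i) h).
have [sol uniq] := stationary_solution T_gt0 xs0 xs_st
  (feasible_of_mass cover xs0 xs1).
exists xs; split => //; have xs_ge0 i : 0 <= xs 0 i by exact: ltW.
apply: cvg_of_kl_cvg0 => //.
(* Feasibility of [xs] now allows it as reference point: its divergence to the iterates converges,
   and the subsequence identifies the limit as 0. *)
have /cvg_ex[l kll] := kl_iterate_cvg xs_ge0 xs1.
have klf := cvg_subseq kf kll.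
by have <- : l = 0 by exact: (cvg_unique _ klf (kl_cvg0 xs0 fxs)).
Qed.

End Convergence.

(** * The cyclic order of the naive Bregman method *)

Theorem proposition4 (R : realType) (n m : nat) (E : {set {set 'I_n}})
    (K : 'I_m -> {set 'I_n}) (c : 'rV[R]_(n + m)) (T : R) (lambda : 'rV[R]_m)
    (hE : is_edge_set E) (hK : is_clique_cover E K)
    (hc : forall j : 'I_m, c 0 (rshift n j) = 0) (hT : 0 < T) :
  exists xs : 'rV[R]_(n + m),
    [/\ is_solution K c T xs,
        forall y : 'rV[R]_(n + m), is_solution K c T y -> y = xs
      & bregman_iterate K c lambda T @ \oo --> xs].
Proof.
have cover (i : 'I_(n + m)) : exists j, i \in ext_clique K j.
  rewrite -(splitK i); case: (fintype.split i) => [k|j] /=.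
    have : k \in [set: 'I_n]%SET by rewrite inE.
    case: hK => _ _ -> /bigcupP[j _ kj]; exists j.
    by rewrite /ext_clique !inE imset_f ?orbT.
  by exists j; rewrite slack_in_ext_clique.
(* Without cliques the cover forces an empty index type, so all vectors coincide. *)
have [m0|m0] := posnP m.
  have noj (j : 'I_m) : False by move: (ltn_ord j); rewrite {2}m0.
  have noi (i : 'I_(n + m)) : False by have [j _] := cover i; exact: noj j.
  have alleq (y z : 'rV[R]_(n + m)) : y = z by apply/rowP => i; case: (noi i).
  exists 0; split=> [||]; last 1 first.
  - by apply: rV_cvg => i; case: (noi i).
  - split=> [|y _]; last by rewrite (alleq y 0).
    by split=> [i|j]; [case: (noi i)|case: (noj j)].
  - by move=> y _; exact: alleq.
apply: (@bregman_cvg _ _ _ _ _ _ _ (fun t => Ordinal (ltn_pmod t m0)) m) => //.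
- by move=> i; rewrite bregman_iterate0 mxE expR_gt0.
- by rewrite bregman_iterate0; exact: stationary_init.
- by move=> t; exact: bregman_iterateS.
(* The witness is [j - t] modulo [m]; adding [m] first keeps the natural subtraction from
   truncating. *)
move=> t j; exists ((m - t %% m + j) %% m)%N; first by rewrite ltnW ?ltn_pmod.
apply: val_inj => /=; rewrite modnDmr addnA -modnDml -(modnDml t).
by rewrite subnKC 1?ltnW ?ltn_pmod // modnn add0n modn_small.
Qed.
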